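(* Let $K$ be an algebraically closed field of characteristic zero, let $E=\{e_1,\dots,e_n\}$ be a finite set, and let $W$ be a nonzero configuration in $K^E$. If $a=[a_1:\cdots:a_n]$ is a point of multiplicity $k$ of the configuration hypersurface $X_W$, with $a_i\neq0$, then the (affine) tangent cone to $X_W$ at $a$ is $$TC_aX_W=\mathcal{V}\Bigg(\sum_{\substack{J\subseteq E,\ |J|=k\\ \dim W^{E-J}=\dim W-k}}C_J\,\Psi_{W^{E-J}}\Big(\tfrac{a}{a_i}\Big)\Big(\tfrac{A}{A_i}-\tfrac{a}{a_i}\Big)^J\Bigg),$$ where the $C_J$ are nonzero constants independent of $a$. The projective tangent cone to $X_W$ at $a$ is $$\mathbb{T}C_aX_W=\mathcal{V}\Bigg(\sum_{\substack{J\subseteq E,\ |J|=k\\ \dim W^{E-J}=\dim W-k}}C_J\,\Psi_{W^{E-J}}\Big(\tfrac{a}{a_i}\Big)\big(a_iA-aA_i\big)^J\Bigg).$$ If $\Psi_W$ is a graph polynomial (first or second), all $C_J=1$.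
   Context: $K^E$ is the vector space with basis $E$, $X_e$ ($e\in E$) are the coordinate functions, and $A_e$ are variables ($A_i=A_{e_i}$). A configuration is a linear subspace $W\subseteq K^E$; for $H\subseteq E$ the restriction is $W^H=W\cap K^H$, where $K^H\subseteq K^E$ is the span of $H$. A configuration polynomial $\Psi_W(A)\in K[A_1,\dots,A_n]$ is defined for a nonzero configuration $W$: if $w_1,\dots,w_m$ is a basis of $W$, it is $\det\big(\sum_eA_eX_e(w_r)X_e(w_s)\big)_{r,s}$, well defined up to a nonzero scalar and homogeneous of degree $m$. $X_W\subset\mathbb{P}(K^E)$ is the hypersurface $\Psi_W=0$, and $\mathcal{V}(\cdot)$ denotes zero locus. A point $a\in X_W$ has multiplicity $k$ if all partial derivatives of $\Psi_W$ of order $<k$ vanish at $a$ and some partial derivative of order $k$ does not. Tangent cones of a hypersurface $\mathcal V(f)$, $f$ homogeneous: for a point $a$ of multiplicity $k$ with $a_i\ne0$, expand $f$ in the affine chart $A_i\neq0$ (coordinates $A_\ell/A_i$) around $a/a_i$ by Taylor's formula. The affine tangent cone $TC_a\mathcal V(f)$ is the zero set of the degree-$k$ (lowest-degree) term in the quantities $\frac{A_\ell}{A_i}-\frac{a_\ell}{a_i}$, and the projective tangent cone $\mathbb{T}C_a\mathcal V(f)\subseteq\mathbb{P}(K^E)$ is the zero set of the homogeneous polynomial obtained from this term by multiplying by $a_i^kA_i^k$. For $J\subseteq E$: $\big(\frac{A}{A_i}-\frac{a}{a_i}\big)^J=\prod_{e_\ell\in J}\big(\frac{A_\ell}{A_i}-\frac{a_\ell}{a_i}\big)$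 and $(a_iA-aA_i)^J=\prod_{e_\ell\in J}(a_iA_\ell-a_\ell A_i)$ (both zero if $e_i\in J$). Graph polynomials: let $G$ be an undirected multigraph with edge set $E$, vertex set $V$ and a chosen orientation, with boundary map $\partial:K^E\to K^V$, $\partial e=h(e)-t(e)$ (head minus tail), and $H_1(G)=\ker\partial\subseteq K^E$. A spanning forest of $G$ is a forest whose components are spanning trees of the components of $G$. The first graph polynomial is $\Psi_G(A)=\sum_F\prod_{e\notin F}A_e$, summed over spanning forests $F$; it is a configuration polynomial for $H_1(G)$ (the determinant above computed in an integral basis of $H_1(G)$). A momentum is $p\in K^V$ whose coordinates sum to zero over each connected component of $G$. A quasi-spanning forest $F$ is a spanning forest with one edge removed (vertices kept); exactly two of its components $T_1,T_2$ are not spanning trees of components of $G$, and $s_F(p)=\big(\sum_{v\in T_1}p_v\big)^2=\big(\sum_{v\in T_2}p_v\big)^2$. The second graph polynomial is $\Phi_G(p,A)=\sum_Fs_F(p)\prod_{e\notin F}A_e$, summed over quasi-spanning forests $F$; for $p\neq0$ it is a configuration polynomial for $H_1(G,p)=\partial^{-1}(Kp)\subseteq K^E$ (computed in a basis consisting of an integral basis of $H_1(G)$ and an element $q$ with $\partial q=p$).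
   Formalization: For the second graph polynomial, when p is no longer a momentum on G−J, Ψ_{W^{E−J}} is normalized as s_F(p)Ψ_{G−J} (F a spanning forest of G−J) instead of Ψ_{G−J}; with Ψ_{G−J} the claim C_J=1 fails. *)

(* Defs.v *)
(* MathComp + multinomials.  The finite set E = {e_1, ..., e_n} is 'I_n, the
   space K^E is 'rV[K]_n, and X_e(w) is the entry w 0 e.  The variable A_e is
   'X_e in {mpoly K[n]}. *)
From HB Require Import structures.
From mathcomp Require Import all_boot all_order all_algebra.
From mathcomp Require Import mpoly.

Set Implicit Arguments.
Unset Strict Implicit.
Unset Printing Implicit Defensive.

Import GRing.Theory.
Local Open Scope ring_scope.

Section Configurations.
Variables (K : fieldType) (n : nat).
Implicit Types (W : {vspace 'rV[K]_n}) (H J : {set 'I_n}).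

Definition coord_space H : {vspace 'rV[K]_n} :=
  (\sum_(e in H) <[delta_mx 0%R e]>)%VS.

Definition restriction W H : {vspace 'rV[K]_n} := (W :&: coord_space H)%VS.

Definition config_matrix m (w : m.-tuple 'rV[K]_n) : 'M[{mpoly K[n]}]_m :=
  \matrix_(r, s) \sum_(e < n) (tnth w r 0 e * tnth w s 0 e) *: 'X_e.

(* Configuration polynomials are only defined up to a nonzero scalar, so P is
   any nonzero multiple of the determinant.  For W = 0 the determinant is empty
   and P is a nonzero constant; this case does occur among the restrictions of
   a nonzero configuration. *)
Definition is_config_poly W (P : {mpoly K[n]}) : Prop :=
  exists (w : (\dim W).-tuple 'rV[K]_n) (c : K),
    [/\ basis_of W w, c != 0 & P = c *: \det (config_matrix w)].

(* dim W^{E-J} = dim W - |J|, written without truncated subtraction. *)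
Definition admissible W J : bool :=
  (\dim W == \dim (restriction W (~: J)) + #|J|)%N.

End Configurations.

(* A point of P(K^E) is represented by any nonzero vector of homogeneous
   coordinates, and a subset of P(K^E) by a predicate on vectors. *)
Section TangentCones.
Variables (K : fieldType) (n : nat).
Implicit Types (f g : {mpoly K[n]}) (a A : 'rV[K]_n) (i : 'I_n).

Definition multiplicity_at f a (k : nat) : Prop :=
  [/\ a != 0,
      f.@[a 0] = 0,
      forall m : 'X_{1..n}, (mdeg m < k)%N -> (f^`M[m]).@[a 0] = 0
    & exists2 m : 'X_{1..n}, mdeg m = k & (f^`M[m]).@[a 0] != 0].

(* The vector A / A_i: the coordinates of A in the chart A_i != 0. *)
Definition chart i A : 'rV[K]_n := (A 0 i)^-1 *: A.

(* f in the chart A_i != 0, written as a polynomial in the quantities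
   'X_l = A_l/A_i - a_l/a_i for l != i; the variable 'X_i does not occur. *)
Definition local_expansion f i a : {mpoly K[n]} :=
  f \mPo [tuple if l == i then 1 else 'X_l + (chart i a 0 l)%:MP | l < n].

Definition taylor_term f i a (k : nat) : {mpoly K[n]} :=
  pihomog mdeg k (local_expansion f i a).

Definition affine_tangent_cone f i a k A : Prop :=
  A 0 i != 0 /\ (taylor_term f i a k).@[(chart i A - chart i a) 0] = 0.

(* Since taylor_term is homogeneous of degree k, multiplying its value at
   A_l/A_i - a_l/a_i by a_i^k A_i^k amounts to substituting
   a_i A_l - a_l A_i. *)
Definition projective_cone_poly f i a k : {mpoly K[n]} :=
  taylor_term f i a k \mPo [tuple a 0 i *: 'X_l - a 0 l *: 'X_i | l < n].

Definition projective_zeros g A : Prop := A != 0 /\ g.@[A 0] = 0.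

Definition projective_tangent_cone f i a k A : Prop :=
  projective_zeros (projective_cone_poly f i a k) A.

(* Zeros in the chart A_i != 0 of a polynomial g in the A_l / A_i. *)
Definition affine_zeros i g A : Prop := A 0 i != 0 /\ g.@[chart i A 0] = 0.

(* Here y l stands for A_l/A_i - a_l/a_i or for a_i A_l - a_l A_i, and PsiR J
   for the configuration polynomial of W^{E-J}. *)
Definition cone_sum (W : {vspace 'rV[K]_n}) (PsiR : {set 'I_n} -> {mpoly K[n]})
    (C : {set 'I_n} -> K) i a (k : nat) (y : 'I_n -> {mpoly K[n]}) :
    {mpoly K[n]} :=
  \sum_(J : {set 'I_n} | (#|J| == k) && admissible W J)
    (C J * (PsiR J).@[chart i a 0]) *: \prod_(l in J) y l.

Definition affine_diff i a (l : 'I_n) : {mpoly K[n]} :=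
  'X_l - (chart i a 0 l)%:MP.

Definition projective_diff i a (l : 'I_n) : {mpoly K[n]} :=
  a 0 i *: 'X_l - a 0 l *: 'X_i.

End TangentCones.

(* Multigraphs with edge set 'I_n; loops and parallel edges are allowed, and
   the graph need not be connected. *)
Record multigraph (n : nat) := Multigraph {
  vertex : finType;
  ghead : 'I_n -> vertex;
  gtail : 'I_n -> vertex
}.

(* An edge set H stands for the subgraph with edges H and all the vertices of
   G; the graph G itself is H = setT and G - J is H = ~: J. *)
Section GraphPolynomials.
Variables (K : fieldType) (n : nat) (G : multigraph n).
Implicit Types (H F : {set 'I_n}) (p : {ffun vertex G -> K}).

Definition adj H : rel (vertex G) := fun u v =>
  [exists e in H, ((ghead G e == u) && (gtail G e == v))
               || ((ghead G e == v) && (gtail G e == u))].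

Definition component H (v : vertex G) : {set vertex G} :=
  [set u | connect (adj H) v u].

(* No edge e of F lies on a cycle of F, i.e. the ends of e are not joined by a
   path in F - e. *)
Definition forest F : bool :=
  [forall e in F, ~~ connect (adj (F :\ e)) (ghead G e) (gtail G e)].

Definition spanning_forest H F : bool :=
  [&& F \subset H, forest F & [forall v, component F v == component H v]].

Definition quasi_spanning_forest H F : bool :=
  [exists e in H :\: F, spanning_forest H (e |: F)].

Definition first_graph_poly H : {mpoly K[n]} :=
  \sum_(F | spanning_forest H F) \prod_(e in H :\: F) 'X_e.

Definition comp_sum H p v : K := \sum_(u in component H v) p u.

Definition momentum H p : bool := [forall v, comp_sum H p v == 0].

(* The square of the sum of p over a component T_1 of the subgraph F that is
   not the vertex set of a component of H.  When there are exactly two such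
   components and p is a momentum on H, it does not matter which is taken. *)
Definition split_square H F p : K :=
  if [pick v | component F v != component H v] is Some v
  then comp_sum F p v ^+ 2 else 0.

Definition second_graph_poly H p : {mpoly K[n]} :=
  \sum_(F | quasi_spanning_forest H F)
    split_square H F p *: \prod_(e in H :\: F) 'X_e.

(* The normalization of the configuration polynomial of H_1(G,p)^{E-J}.  If p
   is still a momentum on G - J, this configuration is H_1(G-J,p).  Otherwise
   it is H_1(G-J), and when its dimension is dim H_1(G,p) - |J| the graph G - J
   has exactly one component more than G: its spanning forests are
   quasi-spanning forests F of G, with a common nonzero s_F(p), and
   deletion of J from the second graph polynomial of G leaves
   s_F(p) Psi_{G-J}. *)
Definition second_graph_poly_del p (J : {set 'I_n}) : {mpoly K[n]} :=
  if momentum (~: J) p then second_graph_poly (~: J) p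
  else split_square setT (~: J) p *: first_graph_poly (~: J).

End GraphPolynomials.

(* Main.v *)
(* A configuration polynomial of W is a determinant in which one may choose the
   basis of W so that 'X_e occurs in a single diagonal entry only; hence its
   derivative by 'X_e is a configuration polynomial of W^{E-e}, or 0 when
   W lies in K^{E-e}.  Iterating, the derivative along J is C_J Psi_{W^{E-J}}
   if dim W^{E-J} = dim W - |J|, and 0 otherwise.  Since Psi_W has degree at
   most one in each variable, its Taylor expansion at b reads
   Psi_W(b + y) = sum_J (d_J Psi_W)(b) y^J, whose part of degree k is the sum in
   the statement.
     The constant C_J is determined by this relation because configuration
   polynomials are nonzero.  For a graph polynomial, d_J keeps exactly the
   forests avoiding J, so once d_J is nonzero it remains to compare the
   (quasi-)spanning forests of G avoiding J with the forests that define the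
   polynomial of G - J. *)
Require Import Defs.
From mathcomp Require Import all_boot all_order all_algebra.
From mathcomp Require Import mpoly.
Import GRing.Theory.
Set Implicit Arguments.
Unset Strict Implicit.
Unset Printing Implicit Defensive.
Local Open Scope ring_scope.

(** * Squarefree monomials and Taylor expansion of multiaffine polynomials *)

Section Multiaffine.
Context {K : fieldType} {n : nat}.
Implicit Types (f : {mpoly K[n]}) (J S : {set 'I_n}) (m : 'X_{1..n}).

(** The exponent of the squarefree monomial of [J]; the iterated derivative with this multi-index is
    the derivative along [J]. *)
Definition indic J : 'X_{1..n} := [multinom (l \in J : nat) | l < n].

Lemma mdeg_indic J : mdeg (indic J) = #|J|.
Proof.
rewrite mdegE -sum1_card [RHS]big_mkcond /=.
by apply: eq_bigr => l _; rewrite mnmE; case: (l \in J).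
Qed.

Lemma mpolyX_indic S : 'X_[K, indic S] = \prod_(l in S) 'X_l.
Proof.
rewrite mpolyXE_id [RHS]big_mkcond /=.
by apply: eq_bigr => l _; rewrite mnmE; case: (l \in S); rewrite ?expr1 ?expr0.
Qed.

Lemma indic_inj : injective indic.
Proof.
move=> S T eqST; apply/setP => l; have /mnmP/(_ l) := eqST.
by rewrite !mnmE; case: (l \in S); case: (l \in T).
Qed.

Lemma indic0 : indic set0 = 0%MM.
Proof. by apply/mnmP => l; rewrite mnmE inE mnm0E. Qed.

Lemma indicU1 e J : e \notin J -> indic (e |: J) = (U_(e) + indic J)%MM.
Proof.
move=> eJ; apply/mnmP => l; rewrite mnmDE !mnmE in_setU1 eq_sym.
by case: eqP => [<-|]; rewrite ?(negPf eJ) ?add0n.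
Qed.

Lemma mderivm_prodX S J :
  (\prod_(l in S) 'X_l : {mpoly K[n]})^`M[indic J] =
  if J \subset S then \prod_(l in S :\: J) 'X_l else 0.
Proof.
rewrite -mpolyX_indic mderivmX; case: ifPn => [JS|/subsetPn[l lJ lS]].
  rewrite big1 ?scale1r => [|l _].
    rewrite -mpolyX_indic; congr 'X_[_]; apply/mnmP => l.
    by rewrite mnmBE !mnmE inE; case: (l \in J); case: (l \in S).
  rewrite !mnmE; have [/(subsetP JS)->|_] := boolP (l \in J); last by rewrite ffactn0.
  by rewrite ffactn1.
by rewrite (bigD1 l) //= !mnmE lJ (negPf lS) scale0r.
Qed.

Lemma mderiv_prod_eq0 (I : Type) (r : seq I) (P : pred I) (F : I -> {mpoly K[n]}) e :
  (forall i, (F i)^`M(e) = 0) -> (\prod_(i <- r | P i) F i)^`M(e) = 0.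
Proof.
move=> F0; elim/big_rec: _ => [|i p _ p0]; first by rewrite -mpolyC1 mderivC.
by rewrite mderivM F0 p0 mul0r mulr0 addr0.
Qed.

Definition multiaffine f := forall m l, (1 < m l)%N -> f@_m = 0.

(** Differentiating twice by ['X_l] multiplies the coefficient at [m] by [m l * (m l - 1)], which is
    invertible in characteristic zero once [m l > 1]. *)
Lemma multiaffine_mderiv f : [pchar K] =i pred0 ->
  (forall l, f^`M(l)^`M(l) = 0) -> multiaffine f.
Proof.
move=> charK f0 m l ml.
have := congr1 (mcoeff (m - (U_(l) + U_(l)))%MM) (f0 l).
rewrite !mcoeff_mderiv mcoeff0 -addmA submK; last first.
  apply/mnm_lepP => j; rewrite mnmDE !mnmE.
  by case: (l =P j) => [<-|].
by move=> /eqP; rewrite -mulrnA -mulr_natr mulf_eq0 ((pcharf0P _).1 charK) orbF => /eqP.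
Qed.

Lemma multiaffineE f : multiaffine f ->
  f = \sum_(S : {set 'I_n}) f@_(indic S) *: \prod_(l in S) 'X_l.
Proof.
move=> fM; apply/mpolyP => m; rewrite raddf_sum /=.
under eq_bigr do rewrite -mpolyX_indic mcoeffZ mcoeffX.
have [/existsP[l ml]|/existsPn ml] := boolP [exists l, (1 < m l)%N].
  rewrite (fM _ _ ml) big1 // => S _; case: eqP => [Sm|]; last by rewrite mulr0.
  by rewrite -Sm mnmE in ml; case: (l \in S) ml.
have em : m = indic [set l | m l == 1%N].
  apply/mnmP => l; rewrite mnmE inE; move: (ml l); rewrite -leqNgt.
  by case: (m l) => [|[]].
rewrite [in RHS]em (bigD1 [set l | m l == 1%N]) //= eqxx mulr1 big1 => [|S SN].
  by rewrite addr0 -em.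
by rewrite (inj_eq indic_inj) (negPf SN) mulr0.
Qed.

(** By linearity it suffices to expand the product of the [y l + b l] over a set [S]. Leaving [y]
    arbitrary allows one increment to be set to zero later. *)
Lemma multiaffine_taylor f (b : 'I_n -> K) k (y : 'I_n -> {mpoly K[k]}) :
  multiaffine f ->
  f \mPo [tuple y l + (b l)%:MP | l < n] =
  \sum_(J : {set 'I_n}) (f^`M[indic J]).@[b] *: \prod_(l in J) y l.
Proof.
move=> /multiaffineE->; rewrite raddf_sum /=.
under [RHS]eq_bigr do rewrite !raddf_sum /= scaler_suml.
rewrite exchange_big /=; apply: eq_bigr => S _; rewrite comp_mpolyZ.
under [RHS]eq_bigr do rewrite mderivmZ mevalZ -scalerA mderivm_prodX.
rewrite -scaler_sumr; congr (_ *: _).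
rewrite rmorph_prod /=.
under eq_bigr do rewrite comp_mpolyXU -tnth_nth tnth_mktuple.
rewrite big_mkcond /=.
(* Factors outside [S] are written [0 + 1], so that distributivity yields a sum over all subsets
   [J]; those not contained in [S] contribute zero. *)
have -> : \prod_l (if l \in S then y l + (b l)%:MP else 1) =
   \prod_l ((if l \in S then y l else 0) +
            (if l \in S then (b l)%:MP else 1%:MP)).
  by apply: eq_bigr => l _; case: ifP => _; rewrite // add0r.
rewrite bigA_distr /=; apply: eq_bigr => J _.
case: ifPn => [JS|/subsetPn[l lJ lS]]; last first.
  by rewrite meval0 scale0r (bigD1 l) //= lJ (negPf lS) mul0r.
rewrite rmorph_prod /= -mul_mpolyC mulrC rmorph_prod /=.
rewrite [X in _ * X]big_mkcond [X in X * _]big_mkcond -big_split /=.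
apply: eq_bigr => l _.
rewrite inE mevalXU; have [lJ|lJ] := boolP (l \in J).
  by rewrite (subsetP JS) //= mulr1.
by rewrite mul1r /=; case: (l \in S).
Qed.

End Multiaffine.

(** * Restrictions of a configuration and derivatives of its polynomial *)

Section ConfigurationPolynomials.
Context {K : fieldType} {n : nat}.
Implicit Types (W : {vspace 'rV[K]_n}) (H J : {set 'I_n}) (P Q : {mpoly K[n]}).

Lemma coord_spaceP H (x : 'rV[K]_n) :
  reflect (forall e, e \notin H -> x 0 e = 0) (x \in coord_space K H).
Proof.
apply: (iffP memv_sumP) => [[v vH ->] e eH|x0].
  rewrite summxE big1 // => l lH; have /vlineP[c ->] := vH l lH.
  by rewrite !mxE eqxx /=; case: eqP eH => [->|]; rewrite ?lH ?mulr0.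
exists (fun e => x 0 e *: delta_mx 0 e) => [e _|]; first exact/memvZ/memv_line.
rewrite {1}[x]row_sum_delta big_mkcond [RHS]big_mkcond /=.
by apply: eq_bigr => e _; case: ifPn => // /x0->; rewrite scale0r.
Qed.

Lemma restrictionP W H (x : 'rV[K]_n) :
  reflect (x \in W /\ forall e, e \notin H -> x 0 e = 0) (x \in restriction W H).
Proof. by apply: (iffP memv_capP) => -[xW /coord_spaceP]. Qed.

Lemma restriction_setT W : restriction W setT = W.
Proof.
apply/vspaceP => x; apply/restrictionP/idP => [[]//|xW].
by split=> // e; rewrite inE.
Qed.

Lemma restriction_restriction W H H' :
  restriction (restriction W H) H' = restriction W (H :&: H').
Proof.
apply/vspaceP => x; apply/restrictionP/restrictionP.
  move=> [/restrictionP[xW xH] xH']; split=> // e.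
  by rewrite inE negb_and => /orP[/xH|/xH'].
move=> [xW x0]; split; last by move=> e eH; apply: x0; rewrite inE negb_and eH orbT.
by apply/restrictionP; split=> // e eH; apply: x0; rewrite inE negb_and eH.
Qed.

(** Frees the length of the basis from the literal form [\dim W], so that a basis such as [v :: w]
    can be used without casts. *)
Lemma is_config_polyP W P :
  (exists m (w : m.-tuple 'rV[K]_n) (c : K),
    [/\ basis_of W w, c != 0 & P = c *: \det (config_matrix w)]) <->
  is_config_poly W P.
Proof.
split=> [[m [w [c [Bw c0 ->]]]]|[w [c wc]]]; last by exists (\dim W), w, c.
by have em := vector.size_basis Bw; subst m; exists w, c.
Qed.

Lemma tuple_lincomb {m} (w w' : m.-tuple 'rV[K]_n) W :
  basis_of W w -> basis_of W w' ->
  exists T : 'M[K]_m, forall r, tnth w' r = \sum_s T r s *: tnth w s.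
Proof.
move=> Bw Bw'; exists (\matrix_(r, s) coord w s (tnth w' r)) => r.
have /(coord_basis Bw) {1}-> := basis_mem Bw' (mem_tnth r w').
by apply: eq_bigr => s _; rewrite mxE [tnth w s](tnth_nth 0).
Qed.

(** The matrix is the Gram matrix of the bilinear form with diagonal coefficients ['X_e], hence it
    changes by congruence. *)
Lemma config_matrix_lincomb {m} (w w' : m.-tuple 'rV[K]_n) (T : 'M[K]_m) :
  (forall r, tnth w' r = \sum_s T r s *: tnth w s) ->
  config_matrix w' =
  map_mx (@mpolyC n K) T *m config_matrix w *m (map_mx (@mpolyC n K) T)^T.
Proof.
move=> wT; apply/matrixP => r s; rewrite !mxE.
under [RHS]eq_bigr do rewrite !mxE mulr_suml.
under [RHS]eq_bigr do under eq_bigr do rewrite !mxE mulr_sumr mulr_suml.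
rewrite exchange_big /=; under [RHS]eq_bigr do rewrite exchange_big /=.
rewrite exchange_big /=; apply: eq_bigr => e _.
rewrite !wT !summxE mulr_suml scaler_suml; apply: eq_bigr => t _.
rewrite mulr_sumr scaler_suml; apply: eq_bigr => u _.
rewrite !mxE -scalerAr -scalerAl [_ * (T s u)%:MP_[n]]mulrC !mul_mpolyC !scalerA.
by congr (_ *: _); rewrite mulrACA mulrC [T r t * _]mulrC mulrA.
Qed.

(** A change of basis [T] multiplies the determinant by [\det T ^+ 2], and freeness of the basis
    makes [T] invertible. *)
Lemma config_poly_unique W P Q :
  is_config_poly W P -> is_config_poly W Q -> exists2 c, c != 0 & P = c *: Q.
Proof.
move=> [w [c [Bw c0 ->]]] [w' [c' [Bw' c'0 ->]]].
have [T wT] := tuple_lincomb Bw' Bw; have [T' wT'] := tuple_lincomb Bw Bw'.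
have TT1 : T *m T' = 1%:M.
  apply/matrixP => r s; have := wT r.
  under eq_bigr do rewrite wT' scaler_sumr.
  rewrite exchange_big /= => eqw.
  apply/eqP; rewrite -subr_eq0; apply/eqP.
  have /freeP/(_ (fun s => (T *m T') r s - (r == s)%:R)) := basis_free Bw.
  rewrite [1%:M r s]mxE; apply; under eq_bigr do rewrite scalerBl -tnth_nth.
  rewrite sumrB [X in _ - X](bigD1 r) //= eqxx scale1r [X in _ - (_ + X)]big1 ?addr0.
    rewrite eqw; apply/eqP; rewrite subr_eq0; apply/eqP; apply: eq_bigr => t _.
    by rewrite mxE scaler_suml; apply: eq_bigr => u _; rewrite scalerA.
  by move=> t; rewrite eq_sym => /negPf->; rewrite scale0r.
have T0 : \det T != 0.
  apply/eqP => T0; have := congr1 determinant TT1.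
  by rewrite det_mulmx det1 T0 mul0r => /esym/eqP; rewrite oner_eq0.
exists (c * \det T ^+ 2 / c').
  by rewrite !mulf_neq0 ?invr_eq0 // expf_neq0.
rewrite (config_matrix_lincomb wT) !det_mulmx det_tr det_map_mx /=.
rewrite mulrC mulrA -mpolyCM mul_mpolyC !scalerA; congr (_ *: _).
by rewrite divfK // expr2.
Qed.

Lemma signr_mpolyC k : (-1) ^+ k = ((-1) ^+ k)%:MP :> {mpoly K[n]}.
Proof. by rewrite rmorphXn /= mpolyCN. Qed.

Lemma mderiv_det_eq0 m (M : 'M[{mpoly K[n]}]_m) e :
  (forall r s, (M r s)^`M(e) = 0) -> (\det M)^`M(e) = 0.
Proof.
move=> M0; rewrite /determinant raddf_sum big1 // => s _.
by rewrite /= signr_mpolyC mderiv_mulC mderiv_prod_eq0 ?mulr0 //.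
Qed.

Lemma mderiv_config_matrix m (w : m.-tuple 'rV[K]_n) r s e :
  (config_matrix w r s)^`M(e) = (tnth w r 0 e * tnth w s 0 e)%:MP.
Proof.
rewrite mxE raddf_sum (bigD1 e) //= big1 ?addr0 => [|l le];
  rewrite mderivZ mderivX mnm1E.
  by rewrite eqxx scale1r -[X in (X - _)%MM]add0m addmK mpolyX0 -alg_mpolyC.
by rewrite (negPf le) scale0r scaler0.
Qed.

(** The hypothesis says that the coordinate [e] vanishes on [W], so no matrix entry involves
    ['X_e]. *)
Lemma mderiv_config_poly_eq0 W P e : is_config_poly W P ->
  restriction W (~: [set e]) = W -> P^`M(e) = 0.
Proof.
move=> [w [c [Bw _ ->]]] We; rewrite mderivZ mderiv_det_eq0 ?scaler0 //.
move=> r s; rewrite mderiv_config_matrix.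
have /restrictionP[_ ->] : tnth w r \in restriction W (~: [set e]).
  by rewrite We (basis_mem Bw) ?mem_tnth.
  by rewrite mul0r mpolyC0.
by rewrite !inE eqxx.
Qed.

Lemma restriction_unit_vector W e : restriction W (~: [set e]) != W ->
  exists2 v, v \in W & v 0 e = 1.
Proof.
move=> We; have [/hasP[v vW ve]|/hasPn W0] :=
  boolP (has (fun v : 'rV_n => v 0 e != 0) (vbasis W)).
  exists ((v 0 e)^-1 *: v); first by rewrite memvZ // vbasis_mem.
  by rewrite mxE mulVf.
case/eqP: We; apply/vspaceP => x; apply/restrictionP/idP => [[]//|xW].
split=> // l; rewrite !inE negbK => /eqP->.
rewrite (coord_vbasis xW) summxE big1 // => r _; rewrite mxE.
have := W0 _ (mem_nth 0 (_ : r < size (vbasis W))%N).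
by rewrite size_tuple negbK => /(_ _)/eqP-> //; rewrite mulr0.
Qed.

(** Subtracting [x 0 e *: v] from a vector [x] of [W] lands in the restriction. *)
Lemma restriction_basis W e v {m} (w : m.-tuple 'rV[K]_n) :
  v \in W -> v 0 e = 1 -> basis_of (restriction W (~: [set e])) w ->
  basis_of W (v :: w).
Proof.
move=> vW ve Bw; have wS := span_basis Bw.
rewrite basisEfree free_cons (basis_free Bw) wS span_cons wS andbT.
apply/and3P; split.
- apply/negP => /restrictionP[_ /(_ e)]; rewrite !inE eqxx ve => /(_ isT)/eqP.
  by rewrite oner_eq0.
- rewrite subv_add -memvE vW; apply/subvP => x.
  by move=> /restrictionP[].
apply: leq_trans (_ : (\dim (<[v]> + restriction W (~: [set e])) <= _)%N); last first.
  apply: leq_trans (dimv_add_leqif _ _) _; rewrite size_tuple (vector.size_basis Bw).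
  by rewrite dim_vline -[m.+1]add1n leq_add2r leq_b1.
apply/dimvS/subvP => x xW; rewrite -[x](subrK (x 0 e *: v)) addrC.
apply: memv_add; first exact/memvZ/memv_line.
apply/restrictionP; split; first by rewrite rpredB // memvZ.
by move=> l; rewrite !inE negbK => /eqP->; rewrite !mxE ve mulr1 subrr.
Qed.

Lemma dim_restriction_C1 W e : restriction W (~: [set e]) != W ->
  \dim W = (\dim (restriction W (~: [set e]))).+1.
Proof.
move=> /restriction_unit_vector[v vW ve].
have /vector.size_basis := restriction_basis vW ve (vbasisP _) : basis_of W [tuple of _].
exact.
Qed.

(** In the basis [v :: w], with [w] a basis of the restriction and [v 0 e = 1], the variable ['X_e]
    occurs only in the top left entry, with coefficient 1. *)
Lemma mderiv_config_poly W P e : is_config_poly W P ->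
  restriction W (~: [set e]) != W ->
  is_config_poly (restriction W (~: [set e])) P^`M(e).
Proof.
move=> WP /restriction_unit_vector[v vW ve].
set W' := restriction W _; pose w := vbasis W'; pose u := [tuple of v :: w].
have Bu : basis_of W u := restriction_basis vW ve (vbasisP W').
have [c c0 ->] : exists2 c, c != 0 & P = c *: \det (config_matrix u).
  apply: config_poly_unique WP _; apply/is_config_polyP.
  by exists _, u, 1; rewrite scale1r oner_neq0.
exists w, c; split=> //; first exact: vbasisP.
rewrite mderivZ; congr (_ *: _).
have we r : tnth w r 0 e = 0.
  have /restrictionP[_ ->] : tnth w r \in W' by rewrite vbasis_mem ?mem_tnth.
    by [].
  by rewrite !inE eqxx.
have uE r : tnth u (lift ord0 r) = tnth w r by rewrite tnthS.
have u0 : tnth u ord0 = v by rewrite tnth0.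
(* Along the first row only the corner term has a nonzero derivative, and its cofactor is the
   determinant for [w]. All cofactors use only rows coming from [w], which are free of ['X_e]. *)
rewrite (expand_det_row _ ord0) raddf_sum big_ord_recl /= big1 ?addr0 => [|r _].
  rewrite mderivM mderiv_config_matrix u0 ve mulr1 mul1r /cofactor expr0 mul1r.
  rewrite mderiv_det_eq0 => [|r s].
    rewrite mulr0 addr0; congr determinant; apply/matrixP => r s.
    by rewrite !mxE !uE.
  by rewrite mxE [X in X^`M(_)]mxE mderiv_config_matrix !uE we mul0r mpolyC0.
rewrite mderivM mderiv_config_matrix uE we mulr0 mpolyC0 mul0r add0r /cofactor.
rewrite signr_mpolyC mderiv_mulC mderiv_det_eq0 ?mulr0 // => s t.
by rewrite mxE [X in X^`M(_)]mxE mderiv_config_matrix uE we mul0r mpolyC0.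
Qed.

Lemma mderivm_indicU1 P e J : e \notin J ->
  P^`M[indic (e |: J)] = P^`M(e)^`M[indic J].
Proof. by move=> eJ; rewrite indicU1 // mderivmDm mderivmU1m. Qed.

Lemma restriction_setU1 W e J :
  restriction W (~: (e |: J)) = restriction (restriction W (~: [set e])) (~: J).
Proof. by rewrite restriction_restriction setCU. Qed.

Lemma finset_ind (T : finType) (P : {set T} -> Prop) :
  P set0 -> (forall x (A : {set T}), x \notin A -> P A -> P (x |: A)) -> forall A, P A.
Proof.
move=> P0 PU A; have [k] := ubnP #|A|; elim: k A => // k IHk A Ak.
have [->//|[x xA]] := set_0Vmem A; rewrite -(setD1K xA).
apply: PU; first by rewrite setD11.
by apply: IHk; move: Ak; rewrite [X in (X < _)%N -> _](cardsD1 x) xA.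
Qed.

Lemma dim_restriction_leq W J : (\dim W <= \dim (restriction W (~: J)) + #|J|)%N.
Proof.
elim/finset_ind: J W => [|e J eJ IHJ] W.
  by rewrite setC0 restriction_setT leq_addr.
rewrite cardsU1 eJ add1n addnS restriction_setU1.
have [We|/dim_restriction_C1->] := eqVneq (restriction W (~: [set e])) W.
  by rewrite We (leq_trans (IHJ W)).
by rewrite ltnS IHJ.
Qed.

(** Induction on [J]. If removing [e] does not change [W], the derivative is zero and the dimension
    bound excludes admissibility; otherwise the dimension drops by exactly one and admissibility
    passes to the restriction. *)
Lemma mderivm_config_poly W P J : is_config_poly W P ->
  if admissible W J then is_config_poly (restriction W (~: J)) P^`M[indic J]
  else P^`M[indic J] = 0.
Proof.
elim/finset_ind: J W P => [|e J eJ IHJ] W P WP; rewrite /admissible.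
  by rewrite setC0 restriction_setT cards0 addn0 eqxx indic0 mderivm0m.
rewrite cardsU1 eJ add1n addnS restriction_setU1 mderivm_indicU1 //.
have [We|We] := eqVneq (restriction W (~: [set e])) W.
  rewrite We ltn_eqF ?ltnS ?dim_restriction_leq //.
  by rewrite (mderiv_config_poly_eq0 WP We) linear0.
by rewrite (dim_restriction_C1 We) eqSS; apply/IHJ/mderiv_config_poly.
Qed.

(** After one derivative the configuration already lies in the span of the elements other than
    [e]. *)
Lemma config_poly_mderiv2 W P e : is_config_poly W P -> P^`M(e)^`M(e) = 0.
Proof.
move=> WP; have [We|We] := eqVneq (restriction W (~: [set e])) W.
  by rewrite (mderiv_config_poly_eq0 WP We) mderiv0.
apply: mderiv_config_poly_eq0 (mderiv_config_poly WP We) _.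
by rewrite restriction_restriction setIid.
Qed.

(** Induction on the dimension: some derivative is the polynomial of a smaller configuration, hence
    nonzero. If every coordinate vanishes on [W], the determinant is empty and the polynomial is the
    constant [c]. *)
Lemma config_poly_neq0 W P : is_config_poly W P -> P != 0.
Proof.
have [k] := ubnP (\dim W); elim: k W P => // k IHk W P Wk WP.
have [/existsP[e We]|/existsPn W0] :=
  boolP [exists e, restriction W (~: [set e]) != W].
  apply: contraNneq (IHk _ _ _ (mderiv_config_poly WP We)) => [->|].
    by rewrite mderiv0.
  by rewrite -ltnS -(dim_restriction_C1 We).
have W00 : \dim W = 0%N.
  apply/eqP; rewrite dimv_eq0 -subv0; apply/subvP => x xW; rewrite memv0.
  apply/eqP/rowP => e; rewrite mxE; move: xW (W0 e); rewrite negbK => xW /eqP eW.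
  by move: xW; rewrite -eW => /restrictionP[_]; apply; rewrite !inE eqxx.
case: WP => w [c [_ c0 ->]]; move: w; rewrite W00 => w.
by rewrite det_mx00 scaler_eq0 oner_eq0 orbF.
Qed.

End ConfigurationPolynomials.

(** * Connectivity and forests when one edge is added *)

Section Connectivity.
Context {n : nat} (G : multigraph n).
Implicit Types (F H : {set 'I_n}) (u v : vertex G).

Local Notation conn H := (connect (adj (G := G) H)).
Local Notation hd := (ghead G).
Local Notation tl := (gtail G).

Lemma conn_sym H : connect_sym (adj (G := G) H).
Proof.
apply: sym_connect_sym => u v; apply/existsP/existsP => -[e /andP[eH]];
  by rewrite orbC => eP; exists e; rewrite eH.
Qed.

Lemma conn_edge H e : e \in H -> conn H (hd e) (tl e).
Proof. by move=> eH; apply/connect1/existsP; exists e; rewrite eH !eqxx. Qed.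

Lemma conn_edges F H : (forall e, e \in H -> conn F (hd e) (tl e)) ->
  subrel (conn H) (conn F).
Proof.
move=> HF; apply: connect_sub => u v /existsP[e /andP[/HF eF]].
by case/orP => /andP[/eqP<- /eqP<-]; rewrite // conn_sym.
Qed.

Lemma connS F H : F \subset H -> subrel (conn F) (conn H).
Proof. by move=> /subsetP FH; apply: conn_edges => e /FH; apply: conn_edge. Qed.

(** A path may be shortened so that it crosses [e] at most once, in one of two directions. *)
Lemma conn_setU1 F e u v :
  conn (e |: F) u v = [|| conn F u v, conn F u (hd e) && conn F (tl e) v
                        | conn F u (tl e) && conn F (hd e) v].
Proof.
apply/idP/idP => [|/or3P[|/andP[ue ev]|/andP[ue ev]]]; first last.
- apply: connect_trans (connS (subsetUr _ _) ue) _.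
  apply: connect_trans (connS (subsetUr _ _) ev).
  by rewrite conn_sym conn_edge ?setU11.
- apply: connect_trans (connS (subsetUr _ _) ue) _.
  apply: connect_trans (connS (subsetUr _ _) ev).
  by rewrite conn_edge ?setU11.
- exact/connS/subsetUr.
case/connectP => p; elim: p u => [|w p IHp] u /=; first by move=> _ ->; rewrite connect0.
case/andP => /existsP[f /andP[]] + + wp /(IHp _ wp).
rewrite in_setU1; have [-> _|_ /= fF] := eqVneq f e.
  by case/orP => /andP[/eqP<- /eqP<-] /or3P[->|/andP[_ ->]|/andP[_ ->]];
    rewrite connect0 ?orbT.
move=> fP; have uw : conn F u w by apply/connect1/existsP; exists f; rewrite fF.
case/or3P => [/(connect_trans uw)->//|/andP[/(connect_trans uw)-> ->]|];
  first by rewrite orbT.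
by case/andP => /(connect_trans uw)-> ->; rewrite !orbT.
Qed.

Definition same_components F H := [forall v, component F v == component (G := G) H v].

Lemma same_componentsP F H : reflect (conn F =2 conn H) (same_components F H).
Proof.
apply: (iffP forallP) => [eFH u v|eFH v].
  by have /eqP/setP/(_ v) := eFH u; rewrite !inE.
by apply/eqP/setP => u; rewrite !inE eFH.
Qed.

Lemma spanning_forestP F H :
  reflect [/\ F \subset H, forest G F & conn F =2 conn H]
    (spanning_forest G H F).
Proof.
by apply: (iffP and3P) => -[? ? ?]; split=> //; apply/same_componentsP.
Qed.

Lemma forestS F F' : F' \subset F -> forest G F -> forest G F'.
Proof.
move=> FF /forallP fF; apply/forallP => e; apply/implyP => eF'.
have /implyP/(_ (subsetP FF _ eF')) := fF e; apply/contra/connS.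
exact: setSD.
Qed.

Lemma forest_setU1 F e : e \notin F ->
  forest G (e |: F) = forest G F && ~~ conn F (hd e) (tl e).
Proof.
move=> eF; apply/idP/andP => [fF|[/forallP fF eN]].
  split; first exact: forestS (subsetUr _ _) fF.
  by have /forallP/(_ e) := fF; rewrite setU11 setU1K.
apply/forallP => f; rewrite in_setU1; apply/implyP.
have [-> _|fe /= fF'] := eqVneq f e; first by rewrite setU1K.
have -> : (e |: F) :\ f = e |: (F :\ f).
  by apply/setP => g; rewrite !inE; case: (g =P f) => [->|//]; rewrite (negPf fe).
have Ff := connS (subsetDl F [set f]).
have ef := conn_edge fF'.
(* A new cycle through [f] would have to cross [e]; its two remaining pieces together with [f] would
   then join the ends of [e] within [F]. *)
have /implyP/(_ fF')/negPf fN := fF f; rewrite conn_setU1 fN /=.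
apply/negP => /orP[] /andP[/Ff fh /Ff tf]; case/negP: eN.
  rewrite conn_sym in fh; rewrite conn_sym in tf.
  exact: connect_trans fh (connect_trans ef tf).
by rewrite conn_sym in ef; apply: connect_trans tf (connect_trans ef fh).
Qed.

(** The dichotomy behind deletion: [H], lying between [F] and [e |: F] in connectivity, has the
    components of one of them. If [H] does not join the ends of [e], two vertices joined by [H]
    cannot need [e], since the pieces of the path in [F] and the connection in [H] would join these
    ends. *)
Lemma conn_intermediate F H e : F \subset H -> subrel (conn H) (conn (e |: F)) ->
  conn H =2 (if conn H (hd e) (tl e) then conn (e |: F) else conn F).
Proof.
move=> /connS FH HF; case: ifPn => [eH|eH] u v; apply/idP/idP.
- exact: HF.
- rewrite conn_setU1 => /or3P[/FH//|/andP[/FH ue /FH ev]|/andP[/FH ue /FH ev]].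
    exact: connect_trans ue (connect_trans eH ev).
  by rewrite conn_sym in eH; apply: connect_trans ue (connect_trans eH ev).
- move=> uv; have := HF _ _ uv; rewrite conn_setU1.
  case/or3P => [//|/andP[/FH ue /FH ev]|/andP[/FH ue /FH ev]]; case/negP: eH.
    rewrite conn_sym in ue; rewrite conn_sym in ev.
    exact: connect_trans ue (connect_trans uv ev).
  by rewrite conn_sym in uv; apply: connect_trans ev (connect_trans uv ue).
- exact: FH.
Qed.

Lemma quasi_spanning_forestP F H :
  reflect (exists2 e, e \in H & [/\ F \subset H, forest G F, ~~ conn F (hd e) (tl e)
                & conn (e |: F) =2 conn H])
    (quasi_spanning_forest G H F).
Proof.
apply: (iffP existsP) => [[e /andP[]]|[e eH [FH fF eF eFH]]].
  rewrite inE => /andP[eF eH] /spanning_forestP[].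
  rewrite subUset forest_setU1 // => /andP[_ FH] /andP[fF eN] eFH.
  by exists e.
have eF' : e \notin F by apply: contra eF; apply: conn_edge.
exists e; rewrite inE eF' eH; apply/spanning_forestP; split=> //.
  by rewrite subUset sub1set eH.
by rewrite forest_setU1 // fF.
Qed.

End Connectivity.

(** * Derivatives of graph polynomials as graph polynomials after deletion *)

Section GraphPolynomialDeletion.
Context {K : fieldType} {n : nat} (G : multigraph n).
Implicit Types (F H J : {set 'I_n}) (u v : vertex G) (p : {ffun vertex G -> K}).

Local Notation conn H := (connect (adj (G := G) H)).
Local Notation hd := (ghead G).
Local Notation tl := (gtail G).

Lemma eq_component F H : conn F =2 conn H -> @component n G F =1 component H.
Proof. by move=> eFH v; apply/setP => u; rewrite !inE eFH. Qed.

Lemma mderivm_compl_prod F J :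
  (\prod_(e in setT :\: F) 'X_e : {mpoly K[n]})^`M[indic J] =
  if F \subset ~: J then \prod_(e in ~: J :\: F) 'X_e else 0.
Proof.
rewrite mderivm_prodX setTD subsetC.
by congr (if _ then \prod_(e in pred_of_set _) _ else _); rewrite setDE setIC setDE.
Qed.

(** A nonzero derivative provides a spanning forest of [G] avoiding [J]. Thus deleting [J] preserves
    the components, and the two families of spanning forests coincide. *)
Lemma mderivm_first_graph_poly J :
  (first_graph_poly K G setT)^`M[indic J] != 0 ->
  (first_graph_poly K G setT)^`M[indic J] = first_graph_poly K G (~: J).
Proof.
rewrite /first_graph_poly raddf_sum /=.
under eq_bigr do rewrite mderivm_compl_prod.
rewrite -big_mkcondr /= => dJ.
have [F /andP[/spanning_forestP[_ fF FT] FJ]] :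
    exists F, spanning_forest G setT F && (F \subset ~: J).
  apply/existsP; apply: contraNT dJ => /existsPn noF.
  by rewrite big_pred0 // => F; apply/negbTE.
have JT : conn (~: J) =2 conn setT.
  move=> u v; apply/idP/idP; first exact/connS/subsetT.
  by rewrite -FT; apply: connS.
apply: eq_bigl => F'; apply/andP/spanning_forestP.
  by move=> [/spanning_forestP[_ fF' F'T] F'J]; split=> // u v; rewrite F'T JT.
move=> [F'J fF' F'T]; split=> //; apply/spanning_forestP.
by split=> // u v; rewrite F'T JT.
Qed.

(** Equal components give extensionally equal predicates, for which [pick] chooses the same
    vertex. *)
Lemma eq_split_square F F' H H' p : conn F =2 conn F' -> conn H =2 conn H' ->
  split_square H F p = split_square H' F' p.
Proof.
move=> /eq_component eF /eq_component eH; rewrite /split_square.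
rewrite (eq_pick (Q := [pred v | component F' v != component H' v])) => [|v].
  by case: pickP => // v _; rewrite /comp_sum eF.
by rewrite /= eF eH.
Qed.

Lemma eq_momentum H H' p : conn H =2 conn H' -> momentum H p = momentum H' p.
Proof.
by move=> /eq_component eH; apply: eq_forallb => v; rewrite /comp_sum eH.
Qed.

Lemma split_square_momentum F H p : momentum F p -> split_square H F p = 0.
Proof.
move=> /forallP pF; rewrite /split_square; case: pickP => // v _.
by rewrite (eqP (pF v)) expr0n.
Qed.

Lemma quasi_spanning_forest_conn H F : conn H =2 conn setT ->
  quasi_spanning_forest G setT F && (F \subset H) = quasi_spanning_forest G H F.
Proof.
move=> HT; apply/andP/quasi_spanning_forestP => [[]|].
  case/quasi_spanning_forestP=> [e _ [_ fF eF eFT]] FH.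
  (* The edge [e] completing [F] need not lie in [H]. It is exchanged for an edge [e'] of [H] whose
     ends [F] does not join; without such an edge, [H] could not join the ends of [e]. *)
  have [/existsP[e' /andP[e'H e'F]]|/existsPn noe] :=
      boolP [exists e', (e' \in H) && ~~ conn F (hd e') (tl e')].
    exists e' => //; split=> // u v; apply/idP/idP.
      by apply: connS; rewrite subUset sub1set e'H.
    rewrite HT -eFT; apply: conn_edges => f; rewrite in_setU1.
    have [-> _|_ /= fF'] := eqVneq f e; last by apply: conn_edge; rewrite setU1r.
    (* The ends of [e'] are joined only by crossing [e]; reversing this path joins the ends of [e]
       by crossing [e']. *)
    have : conn (e |: F) (hd e') (tl e') by rewrite eFT -HT conn_edge.
    rewrite !conn_setU1 (negPf e'F) /=.
    case/orP => /andP[e1 e2]; last by rewrite e1 e2 !orbT.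
    by rewrite [conn F (hd e) (hd e')]conn_sym e1 [conn F (tl e') _]conn_sym e2 orbT.
  case/negP: eF; have : conn H (hd e) (tl e) by rewrite HT -eFT conn_edge ?setU11.
  by apply: conn_edges => f fH; have := noe f; rewrite fH negbK.
move=> [e eH [FH fF eF eFH]]; split=> //; apply/quasi_spanning_forestP.
by exists e => //; split; rewrite ?subsetT // => u v; rewrite eFH HT.
Qed.

(** A nonzero derivative provides a quasi-spanning forest [F0] avoiding [J] with nonzero
    [split_square]. By [conn_intermediate], deleting [J] leaves the components either of [G] or of
    [F0], and the two cases match the definition of [second_graph_poly_del]. *)
Lemma mderivm_second_graph_poly p J : momentum setT p ->
  (second_graph_poly setT p)^`M[indic J] != 0 ->
  (second_graph_poly setT p)^`M[indic J] = second_graph_poly_del p J.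
Proof.
move=> pT; rewrite /second_graph_poly_del /second_graph_poly raddf_sum /=.
under eq_bigr do rewrite mderivmZ mderivm_compl_prod (fun_if ( *:%R _)) scaler0.
rewrite -big_mkcondr /= => dJ.
have [F0 /and3P[/quasi_spanning_forestP[e _ [_ fF eF eFT]] FJ sF]] : exists F,
    [&& quasi_spanning_forest G setT F, F \subset ~: J & split_square setT F p != 0].
  apply/existsP; apply: contraNT dJ => /existsPn noF.
  apply/eqP/big1 => F /andP[qF FJ]; have := noF F.
  by rewrite qF FJ /= negbK => /eqP->; rewrite scale0r.
have HT : subrel (conn (~: J)) (conn (e |: F0)).
  by move=> u v uv; rewrite eFT; apply: connS uv; apply: subsetT.
have := conn_intermediate FJ HT; case: ifPn => [eJ|eJ] JF.
  have JT : conn (~: J) =2 conn setT by move=> u v; rewrite JF eFT.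
  rewrite (eq_momentum _ JT) pT; apply: eq_big => F.
    exact: quasi_spanning_forest_conn.
  by move=> _; rewrite (eq_split_square (F' := F) (H' := setT) p (H := ~: J)).
(* Here [~: J] has the components of [F0], so a momentum on it would make the coefficient of [F0]
   vanish. *)
case: ifPn => [pJ|_].
  by case/eqP: sF; apply: split_square_momentum; rewrite -(eq_momentum _ JF).
rewrite /first_graph_poly scaler_sumr.
(* Since [~: J] does not join the ends of [e], a quasi-spanning forest of [G] inside it cannot have
   fewer components than needed: it already spans the components of [~: J]. *)
have qJ F : quasi_spanning_forest G setT F && (F \subset ~: J) =
            spanning_forest G (~: J) F.
  apply/andP/spanning_forestP => [[/quasi_spanning_forestP[f _ [_ fF' fN fFT]] FJ']|].
    split=> // u v.
    have HT' : subrel (conn (~: J)) (conn (f |: F)).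
      by move=> x y xy; rewrite fFT; apply: connS xy; apply: subsetT.
    have := conn_intermediate FJ' HT'; case: ifPn => [_ JT|_ -> //].
    by case/negP: eJ; rewrite JT fFT -eFT conn_edge ?setU11.
  move=> [FJ' fF' FJ'']; split=> //; apply/quasi_spanning_forestP.
  have FF x y : conn F x y = conn F0 x y by rewrite FJ'' JF.
  by exists e => //; split=> // [|u v]; rewrite ?FF // -eFT !conn_setU1 !FF.
apply: eq_big => // F; rewrite qJ => /spanning_forestP[_ _ FJ'].
(* All these forests have the components of [~: J], hence a common coefficient. *)
by rewrite (eq_split_square (F' := ~: J) (H' := setT)).
Qed.

End GraphPolynomialDeletion.

(** * The Taylor term as a sum over subsets, and the two tangent cones *)

Section TangentConeSums.
Context {K : fieldType} {n : nat}.
Implicit Types (f : {mpoly K[n]}) (a A : 'rV[K]_n) (i : 'I_n).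

Lemma taylor_termE f i a k : multiaffine f -> a 0 i != 0 ->
  taylor_term f i a k =
  \sum_(J : {set 'I_n} | #|J| == k)
    (f^`M[indic J]).@[chart i a 0] *: \prod_(l in J) (if l == i then 0 else 'X_l).
Proof.
move=> fM ai; rewrite /taylor_term /local_expansion.
(* The entry 1 at [i] is [0 + a_i / a_i], so the substitution is a Taylor expansion at the chart
   point with zero increment at [i]; sets [J] containing [i] drop out. *)
have -> : [tuple if l == i then 1 else 'X_l + (chart i a 0 l)%:MP | l < n] =
    [tuple (if l == i then 0 else 'X_l) + (chart i a 0 l)%:MP_[n] | l < n].
  apply: eq_mktuple => l; case: eqP => // ->.
  by rewrite add0r mxE mulVf.
rewrite multiaffine_taylor // raddf_sum /= [RHS]big_mkcond /=.
apply: eq_bigr => J _; rewrite linearZ /=.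
have [iJ|iJ] := boolP (i \in J).
  by rewrite (bigD1 i) //= eqxx mul0r raddf0 scaler0 if_same.
have -> : \prod_(l in J) (if l == i then 0 else 'X_l) = 'X_[indic J] :> {mpoly K[n]}.
  rewrite mpolyX_indic; apply: eq_bigr => l lJ.
  by case: eqP lJ iJ => // -> ->.
by rewrite pihomogX /= mdeg_indic; case: ifP; rewrite ?scaler0.
Qed.

Variables (W : {vspace 'rV[K]_n}) (Psi : {mpoly K[n]}).
Variables (PsiR : {set 'I_n} -> {mpoly K[n]}) (C : {set 'I_n} -> K).
Hypothesis Psi_multiaffine : multiaffine Psi.
Hypothesis Psi_del : forall J,
  Psi^`M[indic J] = if admissible W J then C J *: PsiR J else 0.

(** Treats both cones at once: [y i] vanishes at [x] for the affine and for the projective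
    differences, in agreement with the zero increment at [i] in [taylor_termE]. *)
Lemma cone_sumE i a k (x : 'I_n -> K) (y : 'I_n -> {mpoly K[n]}) :
  a 0 i != 0 -> (y i).@[x] = 0 ->
  (cone_sum W PsiR C i a k y).@[x] =
  (taylor_term Psi i a k).@[fun l => (y l).@[x]].
Proof.
move=> ai yi; rewrite taylor_termE // /cone_sum !raddf_sum /= big_mkcondr /=.
apply: eq_bigr => J _; rewrite Psi_del [RHS]mevalZ.
case: ifP => JW; last by rewrite meval0 mul0r.
rewrite !mevalZ; congr (_ * _); rewrite !rmorph_prod /=; apply: eq_bigr => l _.
by case: eqP => [->|_]; rewrite ?meval0 ?mevalXU.
Qed.

Lemma affine_tangent_coneE i a k A : a 0 i != 0 ->
  affine_tangent_cone Psi i a k A <->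
  affine_zeros i (cone_sum W PsiR C i a k (affine_diff i a)) A.
Proof.
move=> ai; rewrite /affine_tangent_cone /affine_zeros.
have [Ai|Ai] := boolP (A 0 i != 0); last by split=> -[].
have yE l : (affine_diff i a l).@[chart i A 0] = (chart i A - chart i a) 0 l.
  by rewrite /affine_diff mevalB mevalXU mevalC !mxE.
rewrite cone_sumE // ?(meval_eq _ yE) // yE !mxE !mulVf ?subrr //.
Qed.

Lemma projective_tangent_coneE i a k A : a 0 i != 0 ->
  projective_tangent_cone Psi i a k A <->
  projective_zeros (cone_sum W PsiR C i a k (projective_diff i a)) A.
Proof.
move=> ai; rewrite /projective_tangent_cone /projective_zeros.
rewrite cone_sumE //; last by rewrite /projective_diff subrr meval0.
rewrite /projective_cone_poly comp_mpoly_meval.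
by under meval_eq do rewrite tnth_mktuple.
Qed.

End TangentConeSums.

Theorem proposition4p17 (K : closedFieldType) (charK : [pchar K] =i pred0)
    (n : nat) (W : {vspace 'rV[K]_n}) (W_neq0 : W != 0%VS)
    (Psi : {mpoly K[n]}) (PsiR : {set 'I_n} -> {mpoly K[n]})
    (Psi_config : is_config_poly W Psi)
    (PsiR_config : forall J : {set 'I_n},
       is_config_poly (restriction W (~: J)) (PsiR J)) :
  exists C : {set 'I_n} -> K,
    [/\ forall J : {set 'I_n}, C J != 0,
        forall (a : 'rV[K]_n) (k : nat) (i : 'I_n),
          multiplicity_at Psi a k -> a 0 i != 0 ->
          forall A : 'rV[K]_n,
            affine_tangent_cone Psi i a k A <->
            affine_zeros i (cone_sum W PsiR C i a k (affine_diff i a)) A,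
        forall (a : 'rV[K]_n) (k : nat) (i : 'I_n),
          multiplicity_at Psi a k -> a 0 i != 0 ->
          forall A : 'rV[K]_n,
            projective_tangent_cone Psi i a k A <->
            projective_zeros (cone_sum W PsiR C i a k (projective_diff i a)) A,
        forall G : multigraph n,
          Psi = first_graph_poly K G setT ->
          (forall J : {set 'I_n}, admissible W J ->
             PsiR J = first_graph_poly K G (~: J)) ->
          forall J : {set 'I_n}, admissible W J -> C J = 1
      & forall (G : multigraph n) (p : {ffun vertex G -> K}),
          momentum setT p -> p != 0 ->
          Psi = second_graph_poly setT p ->
          (forall J : {set 'I_n}, admissible W J ->
             PsiR J = second_graph_poly_del p J) ->
          forall J : {set 'I_n}, admissible W J -> C J = 1].
Proof.
have Psi_multiaffine : multiaffine Psi.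
  by apply: multiaffine_mderiv => // e; apply: config_poly_mderiv2 Psi_config.
(* The constants compare two configuration polynomials of the same restriction, so they are fixed
   before any point [a]. For an inadmissible [J] the value 1 is a default. *)
have /fin_all_exists[C PsiC] (J : {set 'I_n}) : exists c : K, c != 0 /\
    Psi^`M[indic J] = if admissible W J then c *: PsiR J else 0.
  have := mderivm_config_poly J Psi_config; case: ifP => _ PsiJ.
    by have [c c0 ->] := config_poly_unique PsiJ (PsiR_config J); exists c.
  by exists 1; rewrite oner_neq0.
have C0 J : C J != 0 by have [] := PsiC J.
have Psi_del J : Psi^`M[indic J] = if admissible W J then C J *: PsiR J else 0.
  by have [] := PsiC J.
(* For admissible [J] the derivative is [C J *: PsiR J] with both factors nonzero, which supplies
   the nonvanishing required by the graph lemmas; cancelling [PsiR J] then gives [C J = 1]. *)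
have C1 J : admissible W J ->
    (Psi^`M[indic J] != 0 -> Psi^`M[indic J] = PsiR J) -> C J = 1.
  move=> WJ PsiJ; have PsiR0 := config_poly_neq0 (PsiR_config J).
  move: PsiJ; rewrite Psi_del WJ scaler_eq0 negb_or C0 PsiR0 => /(_ isT)/eqP.
  rewrite -subr_eq0 -{2}[PsiR J]scale1r -scalerBl scaler_eq0 (negPf PsiR0) orbF.
  by rewrite subr_eq0 => /eqP.
exists C; split=> //.
- by move=> a k i _ ai A; apply: affine_tangent_coneE.
- by move=> a k i _ ai A; apply: projective_tangent_coneE.
- move=> G PsiG PsiRG J WJ; apply: C1 => //; rewrite PsiRG // PsiG.
  exact: mderivm_first_graph_poly.
- move=> G p pT _ PsiG PsiRG J WJ; apply: C1 => //; rewrite PsiRG // PsiG.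
  exact: mderivm_second_graph_poly.
Qed.
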